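(* A function $\phi\colon \mathbb{R}\to\mathbb{R}$ is a restricted maximal general dual-feasible function (gDFF) if and only if all of the following conditions hold: (i) $\phi(0)=0$; (ii) $\phi$ is superadditive, i.e. $\phi(x)+\phi(y)\le\phi(x+y)$ for all $x,y\in\mathbb{R}$; (iii) $\phi(x)\ge 0$ for all real $x\ge 0$; (iv) $\phi(x)+\phi(1-x)=1$ for all $x\in\mathbb{R}$.
   Context: A function $\phi\colon\mathbb{R}\to\mathbb{R}$ is a (valid) general dual-feasible function (gDFF) if for every finite family $(x_i)_{i\in I}$ of real numbers (repetitions allowed), $\sum_{i\in I}x_i\le 1$ implies $\sum_{i\in I}\phi(x_i)\le 1$. A gDFF $\phi$ is implied via scaling by a gDFF $\phi_1$ if $\beta\phi_1\ge\phi$ pointwise for some $0\le\beta\le 1$. A gDFF $\phi$ is restricted maximal if it is not implied via scaling by any gDFF $\phi_1\neq\phi$. *)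

(* Defs.v *)
From mathcomp Require Import all_boot all_order all_algebra.
From mathcomp Require Import reals.

Set Implicit Arguments.
Unset Strict Implicit.
Unset Printing Implicit Defensive.

Import Order.TTheory GRing.Theory Num.Theory.

Local Open Scope ring_scope.

(* Families may be empty, and repetitions are allowed since [x] need not be
   injective. *)
Definition gDFF (R : realType) (phi : R -> R) : Prop :=
  forall (I : finType) (x : I -> R),
    \sum_(i : I) x i <= 1 -> \sum_(i : I) phi (x i) <= 1.

(* [phi] is the implied function, [phi1] the implying one. *)
Definition implied_via_scaling (R : realType) (phi phi1 : R -> R) : Prop :=
  exists beta : R, 0 <= beta <= 1 /\ forall x : R, phi x <= beta * phi1 x.

Definition restricted_maximal_gDFF (R : realType) (phi : R -> R) : Prop :=
  gDFF phi /\
  ~ exists phi1 : R -> R,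
      [/\ gDFF phi1, phi1 <> phi & implied_via_scaling phi phi1].

Definition superadditive (R : realType) (phi : R -> R) : Prop :=
  forall x y : R, phi x + phi y <= phi (x + y).

(* Main.v *)
Require Import Defs.
From mathcomp Require Import all_boot all_order all_algebra.
From mathcomp Require Import reals.
From mathcomp Require Import boolp zify ring lra.

Import Order.TTheory GRing.Theory Num.Theory.

Local Open Scope ring_scope.

(** Sufficiency: superadditivity and monotonicity bound every admissible sum
    of values by [phi 1 = 1], so [phi] is a gDFF.  If [phi <= beta * phi1],
    adding the instances at [x] and [1 - x] and using that [phi1] is a gDFF
    gives [1 <= beta * (phi1 x + phi1 (1 - x)) <= beta <= 1]; all of these are
    equalities, which forces [phi1 = phi].

    Necessity: a restricted maximal function cannot be raised at a single
    point [z] ([le_restricted_maximal]).  Raising [phi (x + y)] to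
    [phi x + phi y] keeps a gDFF, because each item [x + y] can be split into
    [x] and [y]; raising [phi z] to [0] for [z >= 0] keeps a gDFF, because
    nonnegative items can be discarded.  This gives superadditivity,
    nonnegativity and [phi 0 = 0].  Rescaling [phi] gives [phi 1 = 1]
    ([restricted_maximal_at1]).

    For the symmetry, suppose that [phi x + phi y = 1 - 2 e] with [y = 1 - x]
    and [e > 0].  Since neither [phi x] nor [phi y] can be raised by [e], there
    are multiplicities [k] and [m] with
      [k (phi x + e) + phi (1 - k x) > 1] and
      [m (phi y + e) + phi (1 - m y) > 1]
    ([raise_obstruction]); both are at least 2 by the choice of [e].  Adding
    [m] times the first inequality to [k] times the second gives
      [m k (1 - 2 e) + 2 m k e + phi (m + k - m k) > m + k],
    by superadditivity and [x + y = 1].  But [m k >= m + k], and [phi n >= n]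
    for natural numbers [n] because [phi 1 = 1]; so
      [phi (m + k - m k) <= - phi (m k - m - k) <= m + k - m k],
    and the previous inequality becomes [m + k > m + k]. *)

Section DualFeasible.
Set Implicit Arguments.
Unset Strict Implicit.
Unset Printing Implicit Defensive.
Context {R : realType}.
Implicit Types (phi : R -> R) (s : seq R) (x y z v e : R) (n : nat).

(** * Dual-feasible functions on lists *)

Lemma gDFF_seqP phi :
  gDFF phi <->
  forall s, \sum_(x <- s) x <= 1 -> \sum_(x <- s) phi x <= 1.
Proof.
split=> [dff s | dff I f].
  by rewrite (big_tnth _ _ s) [X in _ -> X <= 1](big_tnth _ _ s); apply: dff.
by have := dff [seq f i | i : I]; rewrite !big_image.
Qed.

Lemma gDFF_pair phi x y : gDFF phi -> x + y <= 1 -> phi x + phi y <= 1.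
Proof.
by move=> /gDFF_seqP /(_ [:: x; y]); rewrite !big_cons !big_nil !addr0.
Qed.

Definition update phi z v : R -> R := fun x => if x == z then v else phi x.

Lemma sum_update phi z v s :
  \sum_(x <- s) update phi z v x =
  v *+ count_mem z s + \sum_(x <- s | x != z) phi x.
Proof.
rewrite (bigID (pred1 z)) /=; congr (_ + _); last first.
  by apply: eq_bigr => x /negPf xz; rewrite /update xz.
rewrite (eq_bigr (fun=> v)) => [|x xz]; last by rewrite /update xz.
by rewrite big_const_seq iter_addr_0.
Qed.

Lemma gDFF_update phi z v :
  (forall n s, z *+ n + \sum_(x <- s) x <= 1 ->
     v *+ n + \sum_(x <- s) phi x <= 1) ->
  gDFF (update phi z v).
Proof.
move=> ok; apply/gDFF_seqP => s s1; rewrite sum_update -big_filter; apply: ok.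
rewrite big_filter -(sum_update id z z) (eq_bigr id) // => x _.
by rewrite /update; case: eqP.
Qed.

Lemma le_restricted_maximal phi z v :
  restricted_maximal_gDFF phi ->
  (forall n s, z *+ n + \sum_(x <- s) x <= 1 ->
     v *+ n + \sum_(x <- s) phi x <= 1) ->
  v <= phi z.
Proof.
move=> [_ maxphi] ok; rewrite leNgt; apply/negP => lt_v; apply: maxphi.
exists (update phi z v); split; first exact: gDFF_update.
  by move/(congr1 (@^~ z)); rewrite /update eqxx => eqv; rewrite eqv ltxx in lt_v.
exists 1; split=> [|x]; first by rewrite ler01 lexx.
by rewrite mul1r /update; case: eqP => // ->; apply: ltW.
Qed.

(** * Superadditive functions *)

Lemma superadditive_sum phi s : phi 0 = 0 -> superadditive phi ->
  \sum_(x <- s) phi x <= phi (\sum_(x <- s) x).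
Proof.
move=> phi0 sup; elim: s => [|x s IHs]; first by rewrite !big_nil phi0.
by rewrite !big_cons (le_trans _ (sup _ _))// lerD2l.
Qed.

Lemma superadditive_mulrn phi x n : phi 0 = 0 -> superadditive phi ->
  phi x *+ n <= phi (x *+ n).
Proof.
move=> phi0 sup; elim: n => [|n IHn]; first by rewrite !mulr0n phi0.
by rewrite !mulrS (le_trans _ (sup _ _))// lerD2l.
Qed.

Lemma superadditive_homo phi : superadditive phi ->
  (forall x, 0 <= x -> 0 <= phi x) -> {homo phi : x y / x <= y}.
Proof.
move=> sup nng x y le_xy.
have := sup x (y - x); rewrite subrKC; apply: le_trans.
by rewrite lerDl nng // subr_ge0.
Qed.

Lemma superadditive_sum_le phi s x : phi 0 = 0 -> superadditive phi ->
  (forall y, 0 <= y -> 0 <= phi y) ->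
  \sum_(y <- s) y <= x -> \sum_(y <- s) phi y <= phi x.
Proof.
move=> phi0 sup nng /(superadditive_homo sup nng).
exact/le_trans/superadditive_sum.
Qed.

(** * Consequences of restricted maximality *)

Lemma restricted_maximal_superadditive phi :
  restricted_maximal_gDFF phi -> superadditive phi.
Proof.
move=> rm x y; apply: (le_restricted_maximal rm) => n s.
have [/gDFF_seqP/(_ (nseq n x ++ nseq n y ++ s)) + _] := rm.
by rewrite !big_cat !big_nseq !iter_addr_0 /= !addrA !mulrnDl.
Qed.

Lemma restricted_maximal_ge0 phi x :
  restricted_maximal_gDFF phi -> 0 <= x -> 0 <= phi x.
Proof.
move=> rm x0; apply: (le_restricted_maximal rm) => n s s1.
have [/gDFF_seqP dff _] := rm; rewrite mul0rn add0r; apply: dff.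
by rewrite (le_trans _ s1)// lerDr mulrn_wge0.
Qed.

Lemma restricted_maximal_at0 phi : restricted_maximal_gDFF phi -> phi 0 = 0.
Proof.
move=> rm; apply/eqP; rewrite eq_le (restricted_maximal_ge0 rm)// andbT.
by have := restricted_maximal_superadditive rm 0 0; rewrite addr0 gerDl.
Qed.

(** The zero function is implied by any gDFF with factor [0]. *)
Lemma restricted_maximal_neq0 phi :
  restricted_maximal_gDFF phi -> phi <> (fun=> 0).
Proof.
move=> [_ maxphi] phiE; apply: maxphi; exists id; split=> //.
  by rewrite phiE => /(congr1 (@^~ 1)) /eqP; rewrite oner_eq0.
by exists 0; split=> [|x]; rewrite ?lexx ?ler01 // phiE mul0r.
Qed.

(** All admissible sums of values are at most [phi 1].  If [phi 1 < 1], then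
    [phi] divided by some [c < 1] with [phi 1 <= c] is still a gDFF, and it
    implies [phi] with factor [c]. *)
Lemma restricted_maximal_at1 phi : restricted_maximal_gDFF phi -> phi 1 = 1.
Proof.
move=> rm; have [dff maxphi] := rm.
have phi0 := restricted_maximal_at0 rm.
have le_phi1 : phi 1 <= 1.
  by have := @gDFF_pair _ 1 0 dff; rewrite phi0 !addr0; apply.
apply/eqP; rewrite eq_le le_phi1 leNgt; apply/negP => lt_phi1; apply: maxphi.
(* The lower bound 1/2 keeps the factor positive when [phi 1 = 0]. *)
pose c := Num.max (phi 1) 2^-1.
have c_gt0 : 0 < c by rewrite /c lt_max invr_gt0 ltr0n orbT.
have c_lt1 : c < 1 by rewrite /c gt_max lt_phi1 invf_lt1 ?ltr1n ?ltr0n.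
exists (fun x => c^-1 * phi x); split.
- apply/gDFF_seqP => s s1; rewrite -mulr_sumr ler_pdivrMl // mulr1.
  rewrite (@le_trans _ _ (phi 1)) // ?le_max ?lexx //.
  apply: superadditive_sum_le => //; first exact: restricted_maximal_superadditive.
  by move=> y; apply: restricted_maximal_ge0.
- move=> scaleE; apply: (restricted_maximal_neq0 rm); apply/funext => x.
  have /(congr1 (@^~ x)) /= /(congr1 ( *%R c)) := scaleE.
  rewrite mulVKf ?gt_eqF // => /eqP; rewrite -subr_eq0 -{1}[phi x]mul1r -mulrBl.
  by rewrite mulf_eq0 subr_eq0 gt_eqF //= => /eqP.
- exists c; split=> [|x]; first by rewrite !ltW.
  by rewrite mulVKf ?gt_eqF.
Qed.

(** When [n] items equal [z], the best use of the remaining capacity is a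
    single item [1 - z *+ n]; so only these families can prevent [phi z] from
    being raised. *)
Lemma raise_obstruction phi z e : restricted_maximal_gDFF phi -> 0 < e ->
  exists n, 1 < (phi z + e) *+ n + phi (1 - z *+ n).
Proof.
move=> rm e_gt0; apply: contrapT => no_obstruction.
suff : phi z + e <= phi z by rewrite gerDl leNgt e_gt0.
apply: (le_restricted_maximal rm) => n s s1; rewrite leNgt; apply/negP => gt1.
apply: no_obstruction; exists n; rewrite (lt_le_trans gt1)// lerD2l.
apply: superadditive_sum_le; last by rewrite lerBrDl.
- exact: restricted_maximal_at0.
- exact: restricted_maximal_superadditive.
- by move=> y; apply: restricted_maximal_ge0.
Qed.

Lemma restricted_maximal_symmetric phi x :
  restricted_maximal_gDFF phi -> phi x + phi (1 - x) = 1.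
Proof.
move=> rm; have [dff _] := rm.
have phi0 := restricted_maximal_at0 rm.
have phi1 := restricted_maximal_at1 rm.
have sup := restricted_maximal_superadditive rm.
apply/eqP; rewrite eq_le gDFF_pair ?subrKC //= leNgt; apply/negP => lt1.
pose y := 1 - x; pose e := (1 - phi x - phi y) / 2.
have e_gt0 : 0 < e by rewrite /e /y; lra.
have obstr z : phi z + phi (1 - z) = phi x + phi y ->
    exists2 n, (1 < n)%N & 1 < n%:R * (phi z + e) + phi (1 - z *+ n).
  move=> zE; have [[|[|n]]] := raise_obstruction z rm e_gt0.
  - by rewrite !mulr0n subr0 add0r phi1 ltxx.
  - by rewrite !mulr1n /e; lra.
  - by exists n.+2; rewrite // mulr_natl.
have [k k_gt1 kP] := obstr x erefl.
have [|m m_gt1 mP] := obstr y; first by rewrite subKr addrC.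
have le_mk : (m + k <= m * k)%N by nia.
pose d : R := (m * k - (m + k))%:R.
have dE : d = m%:R * k%:R - (m%:R + k%:R) by rewrite /d natrB // natrM natrD.
have phi_d : d <= phi d.
  by have := superadditive_mulrn 1 (m * k - (m + k)) phi0 sup; rewrite phi1.
have phi_Nd : phi d + phi (- d) <= 0 by have := sup d (- d); rewrite subrr phi0.
have le_kx := superadditive_mulrn (1 - x *+ k) m phi0 sup.
have le_my := superadditive_mulrn (1 - y *+ m) k phi0 sup.
have := sup ((1 - x *+ k) *+ m) ((1 - y *+ m) *+ k).
have -> : (1 - x *+ k) *+ m + (1 - y *+ m) *+ k = - d.
  by rewrite dE /y; ring.
have {kP} : m%:R * 1 < m%:R * (k%:R * (phi x + e) + phi (1 - x *+ k)).
  by rewrite ltr_pM2l // ltr0n ltnW.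
have {mP} : k%:R * 1 < k%:R * (m%:R * (phi y + e) + phi (1 - y *+ m)).
  by rewrite ltr_pM2l // ltr0n ltnW.
have eE : phi y = 1 - 2 * e - phi x by rewrite /e; lra.
move: le_kx le_my; rewrite eE.
rewrite -(mulr_natl (phi _) m) -(mulr_natl (phi _) k); lra.
Qed.

End DualFeasible.

Theorem theorem3 (R : realType) (phi : R -> R) :
  restricted_maximal_gDFF phi <->
  [/\ phi 0 = 0,
      superadditive phi,
      (forall x : R, 0 <= x -> 0 <= phi x)
    & (forall x : R, phi x + phi (1 - x) = 1)].
Proof.
split=> [rm | [phi0 sup nng sym]].
  split; first exact: restricted_maximal_at0.
  - exact: restricted_maximal_superadditive.
  - by move=> x; apply: restricted_maximal_ge0.
  - by move=> x; apply: restricted_maximal_symmetric.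
have phi1 : phi 1 = 1 by have := sym 0; rewrite phi0 add0r subr0.
split.
  by apply/gDFF_seqP => s s1; rewrite -phi1; apply: superadditive_sum_le.
move=> [psi [dff neq [b [/andP[b0 b1] le_phi]]]]; apply: neq.
have psi_le x : psi x + psi (1 - x) <= 1 by rewrite gDFF_pair // subrKC.
have bE : b = 1.
  have := sym 0; have := le_phi 0; have := le_phi (1 - 0).
  have := psi_le 0; nra.
apply/funext => x; have := sym x; have := psi_le x.
have := le_phi x; have := le_phi (1 - x); rewrite bE; lra.
Qed.
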